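(* Suppose $U\in\mathcal{CU}_\mu(\mathbb C^J)$ and $\mathcal D_1,\mathcal D_2$ are diagonal unitary operators on $\mathbb C^J$. Then $\mathfrak h(\mathcal D_1U\mathcal D_2)=\mathfrak h(U)$.
   Context: Let $J\ge1$ and $\mu_0,\dots,\mu_{J-1}>0$ be the first $J$ terms of a sequence $(\mu_j)_{j\in\mathbb N_0}$ of positive numbers with sum $1$ (or positive numbers themselves summing to $1$). $\mathbb C^J$ carries $\langle x,y\rangle=\sum_{j=0}^{J-1}\mu_jx_j\overline{y_j}$, $\|x\|=\sqrt{\langle x,x\rangle}$, and $\mathcal{CU}_\mu(\mathbb C^J)$ is the set of linear operators $U$ on $\mathbb C^J$ with $\|Ux\|\le\|x\|$ for all $x$; unitary means unitary for this scalar product. Let $(Ux)_j=\sum_kU_{jk}x_k$ and let $b(U)=\mathbf B$ be the $J\times J$ matrix $\mathbf B_{jk}=\frac{\mu_j}{\mu_k}|U_{jk}|^2$. $\mathcal P_{\mathrm{Ker}(\mathbf B-I)}$ is the projection of $\mathbb C^J$ onto $\mathrm{Ker}(\mathbf B-I)$ along $\mathrm{Im}(\mathbf B-I)$ (these are complementary), and $\mathcal P^T$ its transpose. With $\mu=(\mu_0,\dots,\mu_{J-1})$, $e=(1,\dots,1)$ and $0\log0=0$, the entropy of $U$ is $$\mathfrak h(U)=-\sum_{j,k=0}^{J-1}\big(\mathcal P^T_{\mathrm{Ker}(\mathbf B-I)}e\big)_j\,\mathbf B_{jk}\,\big(\mathcal P_{\mathrm{Ker}(\mathbf B-I)}\mu\big)_k\log\mathbf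 B_{jk}.$$ *)

(* Defs.v *)
From HB Require Import structures.
From mathcomp Require Import all_boot all_order all_algebra.
From mathcomp Require Import complex.
From mathcomp Require Import all_classical all_reals all_analysis.
Import Order.TTheory GRing.Theory Num.Theory.
Import numFieldNormedType.Exports.

Set Implicit Arguments.
Unset Strict Implicit.
Unset Printing Implicit Defensive.

Local Open Scope classical_set_scope.
Local Open Scope ring_scope.
Local Open Scope complex_scope.

(* Operators on C^J are identified with their matrices acting on column
   vectors, (U x)_j = \sum_k U_jk x_k. *)

Section KernelProjection.
Variables (F : fieldType) (n : nat).
Implicit Type A : 'M[F]_n.

(* Projection of the space of column vectors onto Ker A along Im A.  The
   transposes are there because kermx and proj_mx are about row vectors.  The
   value is meaningful when Ker A and Im A intersect trivially (they are then
   complementary): see ker_proj_ker and ker_proj_im. *)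
Definition ker_proj A : 'M[F]_n := (proj_mx (kermx A^T) A^T)^T.

Lemma ker_proj_ker A (x : 'cV[F]_n) :
  (kermx A^T :&: A^T = 0)%MS -> A *m x = 0 -> ker_proj A *m x = x.
Proof.
move=> dA Ax0; apply: trmx_inj; rewrite trmx_mul trmxK proj_mx_id //.
by apply/sub_kermxP; rewrite -trmx_mul Ax0 trmx0.
Qed.

Lemma ker_proj_im A (x : 'cV[F]_n) :
  (kermx A^T :&: A^T = 0)%MS -> ker_proj A *m (A *m x) = 0.
Proof.
move=> dA; apply: trmx_inj; rewrite trmx_mul trmxK trmx0 proj_mx_0 //.
by rewrite trmx_mul submxMl.
Qed.

End KernelProjection.

Section Entropy.
Variables (R : realType) (J : nat) (mu : 'I_J -> R).
Implicit Types (U D : 'M[R[i]]_J) (x y : 'cV[R[i]]_J).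

(* The weights are either the first J terms of an infinite sequence of positive
   numbers of sum 1, or themselves of sum 1. *)
Definition admissible : Prop :=
  (exists nu : nat -> R,
     [/\ forall n, 0 < nu n,
         series nu @ \oo --> (1 : R)
       & forall j : 'I_J, mu j = nu j])
  \/ ((forall j, 0 < mu j) /\ \sum_j mu j = 1).

Definition dot_mu x y : R[i] := \sum_j (mu j)%:C * x j 0 * (y j 0)^*%R.

Definition norm_mu x : R[i] := sqrtC (dot_mu x x).

Definition mu_contraction U : Prop := forall x, norm_mu (U *m x) <= norm_mu x.

Definition mu_unitary D : Prop :=
  D \in unitmx /\ forall x y, dot_mu (D *m x) (D *m y) = dot_mu x y.

Definition bmx U : 'M[R]_J :=
  \matrix_(j, k) (mu j / mu k * ComplexField.Normc.normc (U j k) ^+ 2).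

Definition bproj U : 'M[R[i]]_J :=
  ker_proj (map_mx (real_complex R) (bmx U) - 1%:M).

(* The sum is taken in C, where the projection lives.  The library's ln
   vanishes at 0, so that 0 * ln 0 = 0. *)
Definition entropy U : R[i] :=
  - \sum_j \sum_k
      ((bproj U)^T *m const_mx 1 : 'cV_J) j 0 * (bmx U j k)%:C *
      (bproj U *m (\col_l (mu l)%:C)) k 0 * (ln (bmx U j k))%:C.

End Entropy.

(* Main.v *)
Require Import Defs.
From mathcomp Require Import all_boot all_order all_algebra.
From mathcomp Require Import complex.
From mathcomp Require Import all_classical all_reals all_analysis.
Import Order.TTheory GRing.Theory Num.Theory.
Local Open Scope ring_scope.
Local Open Scope complex_scope.

(** The entropy sees the operator only through [bmx], hence only through the moduli of its entries.
    A diagonal unitary has diagonal entries of modulus 1 ([diag_mu_unitary_normc]), so multiplying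
    by such operators on either side changes only the phases of the entries and leaves [bmx] fixed
    ([bmx_diag_unitary]). *)

Lemma admissible_gt0 (R : realType) (J : nat) (mu : 'I_J -> R) (j : 'I_J) :
  admissible mu -> 0 < mu j.
Proof. by case=> [[nu [nu_gt0 _ ->]]|[]]. Qed.

(** The scalar [a] lets one formula serve both a basis vector ([a = 1]) and its image under a
    diagonal matrix. *)
Lemma dot_mu_delta (R : realType) (J : nat) (mu : 'I_J -> R) (a : R[i])
    (j : 'I_J) :
  dot_mu mu (a *: delta_mx j 0) (a *: delta_mx j 0)
    = (mu j)%:C * `|a| ^+ 2.
Proof.
rewrite /dot_mu (bigD1 j) //= big1 => [|k k_neq_j]; rewrite !mxE.
  by rewrite !eqxx mulr1 addr0 -mulrA -normCK.
by rewrite (negbTE k_neq_j) !mulr0 mul0r.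
Qed.

(** Basis vectors are eigenvectors of [diag_mx d]; preserving their squared norm [mu j] forces the
    eigenvalue to be unimodular, since [mu j] can be cancelled. *)
Lemma diag_mu_unitary_normc (R : realType) (J : nat) (mu : 'I_J -> R)
    (d : 'rV[R[i]]_J) (j : 'I_J) :
  0 < mu j -> mu_unitary mu (diag_mx d) ->
  ComplexField.Normc.normc (d 0 j) = 1.
Proof.
move=> mu_gt0 [_ /(_ (delta_mx j 0) (delta_mx j 0))].
have -> : diag_mx d *m delta_mx j 0 = d 0 j *: delta_mx j 0 :> 'cV_J.
  apply/matrixP => i k; rewrite mul_diag_mx !mxE.
  by case: eqP => [->|] //=; rewrite !mulr0.
rewrite dot_mu_delta -[delta_mx j 0]scale1r dot_mu_delta normr1 expr1n.
have muC_neq0 : (mu j)%:C != 0 :> R[i] by rewrite fmorph_eq0 gt_eqF.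
move=> /(mulfI muC_neq0)/eqP.
(* The norm in [R[i]] is the real [normc] embedded with zero imaginary part; comparing real parts
   gives the claim in [R]. *)
by rewrite sqrp_eq1 // => /eqP[].
Qed.

Lemma bmx_diag_unitary (R : realType) (J : nat) (mu : 'I_J -> R)
    (U D1 D2 : 'M[R[i]]_J) :
  (forall j, 0 < mu j) ->
  is_diag_mx D1 -> mu_unitary mu D1 -> is_diag_mx D2 -> mu_unitary mu D2 ->
  bmx mu (D1 *m U *m D2) = bmx mu U.
Proof.
move=> mu_gt0 /diag_mxP[d1 ->] D1_unitary /diag_mxP[d2 ->] D2_unitary.
apply/matrixP => j k; rewrite mul_mx_diag mul_diag_mx !mxE.
rewrite !ComplexField.Normc.normcM.
by rewrite !(diag_mu_unitary_normc _ _ mu) // mul1r mulr1.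
Qed.

Theorem lemma7p1 (R : realType) (J : nat) (J_ge1 : (1 <= J)%N)
    (mu : 'I_J -> R) (mu_adm : admissible mu)
    (U D1 D2 : 'M[R[i]]_J) (U_contraction : mu_contraction mu U)
    (D1_diag : is_diag_mx D1) (D1_unitary : mu_unitary mu D1)
    (D2_diag : is_diag_mx D2) (D2_unitary : mu_unitary mu D2) :
  entropy mu (D1 *m U *m D2) = entropy mu U.
Proof.
have mu_gt0 j : 0 < mu j by exact: admissible_gt0.
by rewrite /entropy /bproj bmx_diag_unitary.
Qed.
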